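(* Let $X$ be a Polish space. Then $E^C_X \sim_B E^A_{\mathcal{C}(X)}$.
   Context: A continuum is a nonempty compact connected metrizable space (single points are continua); an arc is a homeomorphic copy of $[0,1]$. $\mathcal{C}(X)$ is the hyperspace of all continua contained in $X$, with the Vietoris topology (induced by the Hausdorff metric); it is a Polish space when $X$ is. For a metrizable space $Z$: the continuum-connection relation $E_Z^C$ on $Z$ is $x\,E_Z^C\,y$ iff there is a continuum in $Z$ containing $x$ and $y$; the arc-connection relation $E_Z^A$ on $Z$ is $x\,E_Z^A\,y$ iff $x=y$ or there is an arc in $Z$ containing $x$ and $y$. For equivalence relations $E,F$ on standard Borel spaces $X,Y$ (not necessarily Borel relations), $E\leq_B F$ means that there is a Borel map $f:X\to Y$ with $xEy\iff f(x)Ff(y)$ for all $x,y\in X$, and $E\sim_B F$ means $E\leq_B F$ and $F\leq_B E$. *)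

(* Defs.v *)
From HB Require Import structures.
From mathcomp Require Import all_boot all_order all_algebra.
From mathcomp Require Import all_classical all_reals all_analysis.

Set Implicit Arguments.
Unset Strict Implicit.
Unset Printing Implicit Defensive.
Import Order.TTheory GRing.Theory Num.Theory.
Import numFieldNormedType.Exports.

Local Open Scope classical_set_scope.
Local Open Scope ring_scope.

Section Polish.
Context (R : realType) (X : topologicalType).

Definition is_metric (d : X -> X -> R) : Prop :=
  [/\ forall x y, 0 <= d x y,
      forall x y, d x y = 0 <-> x = y,
      forall x y, d x y = d y x
    & forall x y z, d x z <= d x y + d y z].

Definition induces_topology (d : X -> X -> R) : Prop :=
  forall (x : X) (A : set X),
    nbhs x A <-> exists2 e : R, 0 < e & [set y | d x y < e] `<=` A.

Definition complete_metric (d : X -> X -> R) : Prop :=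
  forall u : nat -> X,
    (forall e : R, 0 < e ->
       exists N : nat, forall m n : nat,
         (N <= m)%N -> (N <= n)%N -> d (u m) (u n) < e) ->
    exists l : X, u @ \oo --> l.

(* The empty space is Polish. *)
Definition polish : Prop :=
  (exists2 D : set X, countable D & dense D) /\
  (exists d : X -> X -> R,
     [/\ is_metric d, induces_topology d & complete_metric d]).

End Polish.

(* Metrizability of K is not required explicitly: these notions are meant for a
   metrizable ambient space, all of whose subspaces are metrizable. *)
Definition is_continuum (X : topologicalType) (K : set X) : Prop :=
  [/\ K !=set0, compact K & connected K].

Definition continua (X : topologicalType) : Type :=
  {K : set X | is_continuum K}.

HB.instance Definition _ (X : topologicalType) := gen_eqMixin (continua X).
HB.instance Definition _ (X : topologicalType) := gen_choiceMixin (continua X).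

(* Subbasis of the Vietoris topology, indexed by (b, U) with U open:
   (true, U) gives the continua contained in U, (false, U) those meeting U. *)
Definition vietoris_subbase (X : topologicalType) (bU : bool * set X) :
    set (continua X) :=
  if bU.1 then [set K | sval K `<=` bU.2]
  else [set K | sval K `&` bU.2 !=set0].

HB.instance Definition _ (X : topologicalType) :=
  isSubBaseTopological.Build (continua X)
    [set bU : bool * set X | open bU.2] (@vietoris_subbase X).

(* The maps are total, but only f on [0, 1] and g on A matter: these restrictions
   are mutually inverse homeomorphisms. *)
Definition is_arc (R : realType) (Z : topologicalType) (A : set Z) : Prop :=
  exists (f : R -> Z) (g : Z -> R),
    [/\ f @` `[0, 1] = A,
        {in `[0, 1], cancel f g},
        {within `[0, 1], continuous f}
      & {within A, continuous g}].

Definition continuum_connected (Z : topologicalType) (x y : Z) : Prop :=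
  exists K : set Z, [/\ is_continuum K, K x & K y].

Definition arc_connected (R : realType) (Z : topologicalType) (x y : Z) : Prop :=
  x = y \/ exists A : set Z, [/\ is_arc R A, A x & A y].

(* Borel sets are taken as a set system instead of through measurableType, which
   would require the space to be nonempty. *)
Definition borel_set (T : topologicalType) : set (set T) := <<s @open T >>.

Definition borel_map (T U : topologicalType) (f : T -> U) : Prop :=
  forall B : set U, borel_set B -> borel_set (f @^-1` B).

Definition borel_reducible (T U : topologicalType)
    (E : T -> T -> Prop) (F : U -> U -> Prop) : Prop :=
  exists f : T -> U,
    borel_map f /\ (forall x y : T, E x y <-> F (f x) (f y)).

Definition borel_bireducible (T U : topologicalType)
    (E : T -> T -> Prop) (F : U -> U -> Prop) : Prop :=
  borel_reducible E F /\ borel_reducible F E.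

(* Main.v *)
Require Import Defs.
From HB Require Import structures.
From mathcomp Require Import all_boot all_order all_algebra.
From mathcomp Require Import all_classical all_reals all_analysis.
From mathcomp Require Import finmap lra.

(* Both directions reduce to one fact: two continua [K] and [L] are
   arc-connected in the hyperspace iff some continuum contains both. The union of
   the members of an arc of continua is a continuum. Conversely, take [N] minimal
   among the continua containing [K] and [L]; a maximal chain of continua between
   [K] and [N] is, by boundary bumping, an arc parametrised by a Whitney map, and
   such arcs from [K] to [N] and from [L] to [N] meet only in [N] by minimality.
   The reductions are then [x |-> {x}] and a Borel choice of a point of each
   continuum. *)

Set Implicit Arguments.
Unset Strict Implicit.
Unset Printing Implicit Defensive.
Import Order.TTheory GRing.Theory Num.Theory.
Import numFieldNormedType.Exports.

Local Open Scope classical_set_scope.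
Local Open Scope ring_scope.

(** * Metric separation and connectedness *)

(** A Whitney map is continuous and strictly increasing along inclusion, so comparable continua with
    equal values coincide, and a chain of continua is embedded in [R] by its values. It remains to
    see that a maximal chain attains every intermediate value. This is the only use of boundary
    bumping: a gap in the chain would be filled by a continuum strictly in between. For the
    reduction back to [X], every choice of a point [s K] in [K] respects the relations, because [K]
    is itself a continuum containing [s K]; the difficulty is to choose in a Borel way. The point is
    found by cutting [K] down successively with the first ball, in a fixed enumeration of the
    centres, that the remaining part meets. A dense sequence thus serves both the Whitney map and
    the selector. *)

Section Metric.
Context (R : realType) (X : topologicalType) (d : X -> X -> R).
Hypotheses (dm : is_metric d) (dt : induces_topology d).

Lemma metric_open_ball (x : X) (e : R) : open [set y | d x y < e].
Proof.
have [_ _ _ dtri] := dm; rewrite openE => y /= dxy.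
apply/(dt y); exists (e - d x y); first by rewrite subr_gt0.
by move=> z /= dyz; have := dtri x y z; lra.
Qed.

Lemma metric_nbhs_ball (x : X) (e : R) : 0 < e -> nbhs x [set y | d x y < e].
Proof. by move=> e0; apply/(dt x); exists e. Qed.

Lemma metric_continuous (x : X) : continuous (d x : X -> R).
Proof.
have [_ _ dC dtri] := dm; move=> y; apply/cvgrPdist_lt => e e0.
apply/(dt y); exists e => // z /= dyz; rewrite ltr_norml.
have := dtri x y z; have := dtri x z y; rewrite (dC z y); lra.
Qed.

Lemma metric_closed_far (x : X) (e : R) : closed [set y | e <= d x y].
Proof.
apply: (@preimage_closed _ _ (d x) [set r | e <= r]); last exact: closed_ge.
by move=> y _; exact: metric_continuous.
Qed.

Lemma metric_closed_ball (x : X) (e : R) : closed [set y | d x y <= e].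
Proof.
apply: (@preimage_closed _ _ (d x) [set r | r <= e]); last exact: closed_le.
by move=> y _; exact: metric_continuous.
Qed.

Lemma metric_space_hausdorff : hausdorff_space X.
Proof.
have [dge0 d0 dC dtri] := dm => x y xy; apply/d0/eqP.
rewrite eq_le dge0 andbT leNgt; apply/negP => dxy.
have e0 : 0 < d x y / 2 by lra.
have [z [/= xz yz]] := xy _ _ (metric_nbhs_ball x e0) (metric_nbhs_ball y e0).
by have := dtri x z y; rewrite (dC z y); lra.
Qed.

(** The radii are at most half the distance to the other set: if two of the balls met, their centres
    would be closer than [e + f], while both [2 * e] and [2 * f] bound that distance from below. *)
Lemma metric_separation (A B : set X) : closed A -> closed B -> A `&` B = set0 ->
  exists U V, [/\ open U, open V, A `<=` U, B `<=` V & U `&` V = set0].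
Proof.
have [dge0 d0 dC dtri] := dm.
have sep (P Q : set X) : closed Q -> P `&` Q = set0 ->
    P `<=` \bigcup_(x in P) \bigcup_(e in [set e | 0 < e /\
      Q `<=` [set y | 2 * e <= d x y]]) [set y | d x y < e].
  move=> Qcl PQ x Px; have /(dt x) [e e0 eQ] : nbhs x (~` Q).
    apply: open_nbhs_nbhs; split; first exact: closed_openC.
    by move=> Qx; rewrite -[False]/(set0 x) -PQ.
  exists x => //; exists (e / 2) => /=.
    split; first by lra.
    move=> y Qy /=; rewrite leNgt; apply/negP => dxy; apply: (eQ y) => //=; lra.
  by rewrite (d0 x x).2 //; lra.
move=> Acl Bcl AB.
exists (\bigcup_(x in A) \bigcup_(e in [set e | 0 < e /\
  B `<=` [set y | 2 * e <= d x y]]) [set y | d x y < e]).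
exists (\bigcup_(x in B) \bigcup_(e in [set e | 0 < e /\
  A `<=` [set y | 2 * e <= d x y]]) [set y | d x y < e]).
split.
- by do 2![apply: bigcup_open => ? _]; exact: metric_open_ball.
- by do 2![apply: bigcup_open => ? _]; exact: metric_open_ball.
- exact: sep.
- by apply: sep; rewrite // setIC.
- rewrite -subset0 => z [[x Ax [e [e0 eB] /= xz]]] [y By [f [f0 fA] /= yz]].
  have := eB _ By; have := fA _ Ax; have := dtri x z y.
  by rewrite /= (dC y x) (dC z y); lra.
Qed.

End Metric.

Lemma connected_subset_open (T : topologicalType) (A U V : set T) :
  connected A -> open U -> open V -> A `<=` U `|` V -> A `&` U `&` V = set0 ->
  A `<=` U \/ A `<=` V.
Proof.
move=> Ac Uo Vo AUV AUV0.
have [[x AUx]|/nonemptyPn AU0] := pselect (A `&` U !=set0); last first.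
  right=> x Ax; have [Ux|//] := AUV _ Ax.
  by have : (A `&` U) x by []; rewrite AU0.
left; apply/setIidPl; apply: Ac; first by exists x.
  by exists U.
exists (~` V); first exact: open_closedC.
apply/seteqP; split=> y [Ay].
  by move=> Uy; split=> // Vy; rewrite -[False]/(set0 y) -AUV0.
by move=> NVy; split=> //; case: (AUV _ Ay).
Qed.

(** The test sets are disjoint in the whole space and not only on [A], so that
    [compact_directed_sub] can carry them from an intersection to one of its members. *)
Lemma closed_connected (R : realType) (X : topologicalType) (d : X -> X -> R)
    (A : set X) : is_metric d -> induces_topology d -> closed A ->
  (forall U V, open U -> open V -> U `&` V = set0 -> A `<=` U `|` V ->
    A `<=` U \/ A `<=` V) ->
  connected A.
Proof.
move=> dm dt Acl AUV B [b Bb] [C Co BC] [D Dc BD].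
have cl1 : closed (A `&` D) by exact: closedI.
have cl2 : closed (A `&` ~` C) by apply: closedI => //; exact: open_closedC.
have dis : (A `&` D) `&` (A `&` ~` C) = set0.
  by rewrite -BD BC -subset0 => x [[_ ?] []].
have [U [V [Uo Vo AU AV UV]]] := metric_separation dm dt cl1 cl2 dis.
have [|AU'|AV'] := AUV U V Uo Vo UV.
- move=> x Ax; have [Cx|Cx] := pselect (C x); [left|right].
    by apply: AU; rewrite -BD BC.
  by apply: AV.
- apply/seteqP; split=> x; first by rewrite BC => -[].
  move=> Ax; rewrite BC; split=> //; apply: contrapT => Cx.
  suff : (U `&` V) x by rewrite UV.
  by split; [exact: AU'|exact: AV].
- have : (U `&` V) b; last by rewrite UV.
  by split; [apply: AU; rewrite -BD|apply: AV'; rewrite BC in Bb; case: Bb].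
Qed.

(** Otherwise the members minus [U] generate a proper filter; a cluster point of it lies in every
    member, all being closed, and yet outside [U]. *)
Lemma compact_directed_sub (T : topologicalType) (S : set (set T)) (U : set T) :
  S !=set0 -> (forall A, S A -> compact A /\ closed A) ->
  (forall A B, S A -> S B -> exists2 C, S C & C `<=` A `&` B) ->
  open U -> \bigcap_(A in S) A `<=` U -> exists2 A, S A & A `<=` U.
Proof.
move=> [A0 SA0] Scc Sdir Uo SU; apply: contrapT => nS.
pose F := filter_from S (fun A => A `\` U).
have FF : ProperFilter F.
  apply: filter_from_proper; last first.
    move=> A SA; apply: contrapT => /nonemptyPn AU.
    by apply: nS; exists A => //; rewrite -setD_eq0.
  apply: filter_from_filter; first by exists A0.
  move=> A B SA SB; have [C SC CAB] := Sdir _ _ SA SB; exists C => //.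
  by move=> x [/CAB[? ?] ?].
have [|x [_ Fx]] := (Scc _ SA0).1 F.
  by exists A0 => // x [].
have FxS A : S A -> (A `\` U) x.
  move=> SA; have cl : closed (A `\` U).
    by apply: closedI; [exact: (Scc _ SA).2|exact: open_closedC].
  by apply: cl => B Bx; apply: Fx => //; exists A.
by have /SU : (\bigcap_(A in S) A) x by [move=> A /FxS[]]; case: (FxS _ SA0).
Qed.

(** * Continua and the Vietoris topology *)

Section Continua.
Context (R : realType) (X : topologicalType) (d : X -> X -> R).
Hypotheses (dm : is_metric d) (dt : induces_topology d).

Lemma continuum_closed (K : set X) : is_continuum K -> closed K.
Proof.
by case=> _ Kc _; apply: compact_closed => //; exact: metric_space_hausdorff dm dt.
Qed.

Lemma continuum_set1 (x : X) : is_continuum [set x].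
Proof. by split; [exists x|exact: compact_set1|exact: connected1]. Qed.

(** Two disjoint open sets covering the intersection already cover some member, whose connectedness
    decides between them. *)
Lemma continuum_bigcap (S : set (set X)) : S !=set0 ->
  (forall A, S A -> is_continuum A) ->
  (forall A B, S A -> S B -> exists2 C, S C & C `<=` A `&` B) ->
  is_continuum (\bigcap_(A in S) A).
Proof.
move=> S0 Sc Sdir; have Scl A : S A -> compact A /\ closed A.
  by move=> /Sc Ac; split; [case: Ac|exact: continuum_closed].
have cl : closed (\bigcap_(A in S) A) by apply: closed_bigI => A /Scl[].
split.
- apply: contrapT => /nonemptyPn SE.
  have [|A /Sc[[x Ax] _ _] A0] := compact_directed_sub S0 Scl Sdir open0.
    by rewrite SE.
  by have := A0 _ Ax.
- have [A SA] := S0; apply: subclosed_compact cl (Scl _ SA).1 _.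
  exact: bigcap_inf.
- apply: closed_connected dm dt cl _ => U V Uo Vo UV SUV.
  have [A SA AUV] := compact_directed_sub S0 Scl Sdir (openU Uo Vo) SUV.
  have [_ _ Ac] := Sc _ SA.
  have [|AU|AV] := connected_subset_open Ac Uo Vo AUV.
  + by rewrite -setIA UV setI0.
  + by left=> x /(_ _ SA)/AU.
  + by right=> x /(_ _ SA)/AV.
Qed.

Lemma continuum_closure_bigcup (S : set (set X)) (L : set X) :
  \bigcap_(A in S) A !=set0 -> S !=set0 ->
  (forall A, S A -> is_continuum A /\ A `<=` L) -> compact L ->
  is_continuum (closure (\bigcup_(A in S) A)).
Proof.
move=> S0 [A SA] SL Lc; split.
- have [[x Ax] _ _] := (SL _ SA).1; exists x; apply: subset_closure.
  by exists A.
- apply: (subclosed_compact _ Lc); first exact: closed_closure.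
  have Lcl : closed L by apply: compact_closed Lc; exact: metric_space_hausdorff dm dt.
  rewrite ((closure_id _).1 Lcl); apply: closureS.
  by apply: bigcup_sub => B /SL[].
- apply: connected_closure; apply: bigcup_connected => //.
  by move=> B /SL[[]].
Qed.

(* The quasi-component of [A] in [B `\` ball x e] is connected; were it equal to
   [A], some clopen part of [B `\` ball x e] would be clopen in [B]. *)
Lemma continuum_between (A B : set X) : is_continuum A -> is_continuum B ->
  A `<` B -> exists C, [/\ is_continuum C, A `<` C & C `<` B].
Proof.
move=> Ac Bc [AB /existsNP[x /not_implyP[Bx Ax]]].
have [[a Aa] _ Acon] := Ac; have [_ Bcomp Bcon] := Bc.
have Acl := continuum_closed Ac; have Bcl := continuum_closed Bc.
have [dge0 d0 _ _] := dm.
(* The inequality is strict so that [A] misses the sphere of radius [e] about [x]: a clopen part of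
   [F] that misses this sphere too is clopen in all of [B]. *)
have [e e0 eA] : exists2 e, 0 < e & A `<=` [set y | e < d x y].
  have /(dt x)[e e0 eA] : nbhs x (~` A).
    by apply: open_nbhs_nbhs; split=> //; exact: closed_openC.
  exists (e / 2); first by lra.
  by move=> y Ay /=; rewrite ltNge; apply/negP => dxy; apply: (eA y) => //=; lra.
pose F := B `&` [set y | e <= d x y].
have Fcl : closed F by apply: closedI => //; exact: metric_closed_far dm dt x e.
pose S := [set Q | [/\ A `<=` Q, Q `<=` F, closed Q & closed (F `\` Q)]].
have SF : S F.
  split=> //; last by rewrite setDv; exact: closed0.
  by move=> y Ay; split; [exact: AB|exact: ltW (eA _ Ay)].
have Sdir P Q : S P -> S Q -> exists2 C, S C & C `<=` P `&` Q.
  move=> [AP PF Pcl FP] [AQ QF Qcl FQ]; exists (P `&` Q) => //; split.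
  - by move=> y Ay; split; [exact: AP|exact: AQ].
  - by move=> y [/PF].
  - exact: closedI.
  - by rewrite setDIr; exact: closedU.
have Scc Q : S Q -> compact Q /\ closed Q.
  move=> [_ QF Qcl _]; split=> //; apply: subclosed_compact Qcl Bcomp _.
  by move=> y /QF[].
have S0 : S !=set0 by exists F.
have AC : A `<=` \bigcap_(Q in S) Q by move=> y Ay Q [AQ _ _ _]; exact: AQ.
have Ccl : closed (\bigcap_(Q in S) Q) by apply: closed_bigI => Q /Scc[].
have CF : \bigcap_(Q in S) Q `<=` F by move=> y; exact.
exists (\bigcap_(Q in S) Q); split.
- split; first by exists a; exact: AC.
    by apply: subclosed_compact Ccl Bcomp _ => y /CF[].
  have aux U V : open U -> open V -> U `&` V = set0 ->
      \bigcap_(Q in S) Q `<=` U `|` V -> A `<=` U -> \bigcap_(Q in S) Q `<=` U.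
    move=> Uo Vo UV CUV AU.
    have [Q SQ QUV] := compact_directed_sub S0 Scc Sdir (openU Uo Vo) CUV.
    have [AQ QF Qcl FQ] := SQ.
    have QU y : Q y -> U y <-> ~ V y.
      move=> Qy; split; last by case: (QUV _ Qy).
      by move=> Uy Vy; rewrite -[False]/(set0 y) -UV.
    (* Inside [Q] the sets [U] and [V] are complementary, so cutting by [U] leaves a clopen part of
       [F]. *)
    suff : S (Q `&` U) by move=> SQU y /(_ _ SQU)[].
    split.
    + by move=> y Ay; split; [exact: AQ|exact: AU].
    + by move=> y [/QF].
    + rewrite (_ : _ `&` _ = Q `&` ~` V).
        by apply: closedI => //; exact: open_closedC.
      by apply/seteqP; split=> y [Qy /(QU _ Qy)].
    + rewrite setDIr; apply: closedU => //.
      by rewrite setDE; apply: closedI => //; exact: open_closedC.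
  apply: closed_connected dm dt Ccl _ => U V Uo Vo UV CUV.
  have [|AU|AV] := connected_subset_open Acon Uo Vo (subset_trans AC CUV).
  + by rewrite -setIA UV setI0.
  + by left; exact: aux UV CUV AU.
  + by right; apply: (aux V U); rewrite // (setIC, setUC).
- split=> // CA.
  have Uo : open [set y | e < d x y].
    rewrite (_ : mkset _ = ~` [set y | d x y <= e]).
      by apply: closed_openC; exact: metric_closed_ball.
    by apply/seteqP; split=> y /=; rewrite ltNge => /negP.
  have [Q [AQ QF Qcl FQ] QU] :=
    compact_directed_sub S0 Scc Sdir Uo (subset_trans CA eA).
  have BQ : Q = B.
    apply: Bcon; first by exists a; exact: AQ.
      exists (~` ((F `\` Q) `|` [set y | d x y <= e])).
        apply: closed_openC; apply: closedU => //.
        exact: metric_closed_ball dm dt x e.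
      apply/seteqP; split=> y.
        move=> Qy; split; first by case: (QF _ Qy).
        move=> [[_ //]|/= dxy]; have := QU _ Qy; rewrite /= ltNge.
        by rewrite dxy.
      move=> [By nQ]; apply: contrapT => Qy; apply: nQ.
      have [dxy|dxy] := leP (d x y) e; [by right|left; split=> //].
      by split=> //; exact: ltW.
    exists Q => //; apply/seteqP; split=> [y Qy|y []//].
    by split=> //; case: (QF _ Qy).
  have /QF[_ /=] : Q x by rewrite BQ.
  by rewrite (d0 x x).2 // leNgt e0.
- split; first by move=> y /CF[].
  move=> BC; have /CF[_ /=] := BC _ Bx.
  by rewrite (d0 x x).2 // leNgt e0.
Qed.

End Continua.

Section Vietoris.
Context (X : topologicalType).
Implicit Types (K L : continua X) (U : set X) (F : set_system (continua X)).

Lemma continua_eq K L : sval K = sval L -> K = L.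
Proof. by case: K L => [K Kc] [L Lc] /= KL; exact: eq_exist. Qed.

Lemma vietoris_subbase_nbhs K (bU : bool * set X) :
  open bU.2 -> vietoris_subbase bU K -> nbhs K (vietoris_subbase bU).
Proof.
move=> Uo KU; rewrite nbhsE; exists (vietoris_subbase bU) => //; split=> //.
exists [set vietoris_subbase bU]; last by rewrite bigcup_set1.
move=> _ ->; exists [fset bU]%fset; last by rewrite set_fset1 bigcap_set1.
by move=> ?; rewrite !inE => /eqP ->; apply: mem_set; exact: Uo.
Qed.

Lemma vietoris_sub_nbhs K U : open U -> sval K `<=` U ->
  nbhs K [set L : continua X | sval L `<=` U].
Proof. by move=> Uo; exact: (@vietoris_subbase_nbhs K (true, U)). Qed.

Lemma vietoris_meet_nbhs K U : open U -> sval K `&` U !=set0 ->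
  nbhs K [set L : continua X | sval L `&` U !=set0].
Proof. by move=> Uo; exact: (@vietoris_subbase_nbhs K (false, U)). Qed.

Lemma cvg_vietoris F K : Filter F ->
  (forall U, open U -> sval K `<=` U -> F [set L : continua X | sval L `<=` U]) ->
  (forall U, open U -> sval K `&` U !=set0 ->
    F [set L : continua X | sval L `&` U !=set0]) ->
  F --> K.
Proof.
move=> FF Fsub Fmeet A; rewrite nbhsE => -[_ [[D DI <-] [B DB BK]] DA].
rewrite nbhs_filterE; apply: filterS DA _; apply: (@filterS _ _ _ B).
  by move=> L BL; exists B.
have [I Io IB] := DI _ DB; rewrite -IB; apply: filter_bigI => -[b U] IbU.
have Uo : open U := set_mem (Io _ IbU).
have : vietoris_subbase (b, U) K by move: BK; rewrite -IB; exact.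
by case: b {IbU} => /=; [exact: Fsub|exact: Fmeet].
Qed.

Lemma vietoris_open_sub U : open U -> open [set K : continua X | sval K `<=` U].
Proof. by move=> Uo; rewrite openE => K KU; exact: vietoris_sub_nbhs. Qed.

Lemma vietoris_closed_meet (C : set X) :
  closed C -> closed [set K : continua X | sval K `&` C !=set0].
Proof.
move=> Ccl; rewrite (_ : mkset _ = ~` [set K : continua X | sval K `<=` ~` C]).
  by apply: open_closedC; apply: vietoris_open_sub; exact: closed_openC.
apply/seteqP; split=> K /=; first by move=> [x [Kx Cx]] /(_ _ Kx).
by move=> /existsNP[x /not_implyP[Kx /contrapT Cx]]; exists x.
Qed.

Lemma set1_continuous (f : X -> continua X) :
  (forall x, sval (f x) = [set x]) -> continuous f.
Proof.
move=> fE x; apply: cvg_vietoris => U Uo /=; rewrite fE => xU.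
  have : nbhs x U by apply: open_nbhs_nbhs; split=> //; exact: xU.
  by apply: filterS => y Uy; rewrite /= fE => _ ->.
have : nbhs x U.
  by apply: open_nbhs_nbhs; split=> //; case: xU => _ [-> ].
by apply: filterS => y Uy; rewrite /= fE; exists y.
Qed.

(* If a filter containing the union clustered nowhere in it, then each [K0] in
   [A] would have a neighbourhood missing a member of the filter. *)
Lemma compact_bigcup_continua (A : set (continua X)) :
  compact A -> compact (\bigcup_(K in A) sval K).
Proof.
move=> Ac F FF FA.
pose G := filter_from F (fun B => A `&` [set K : continua X | sval K `&` B !=set0]).
have GF : ProperFilter G.
  apply: filter_from_proper; last first.
    move=> B FB; have [x [[K AK Kx] Bx]] := filter_ex (filterI FA FB).
    by exists K; split=> //; exists x.
  apply: filter_from_filter; first by exists setT; exact: filterT.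
  move=> B C FB FC; exists (B `&` C); first exact: filterI.
  by move=> K [AK [x [Kx [Bx Cx]]]]; split; split=> //; exists x.
have [|K0 [AK0 clK0]] := Ac G.
  by exists setT; [exact: filterT|move=> K []].
apply: contrapT => /nonemptyPn nF.
have [_ /compact_near_coveringP K0c _] := svalP K0.
(* Each point of [K0] avoids the closure of some member of [F]; the near-covering form of
   compactness, taken along ever smaller members, yields one member that serves all points. *)
have : \forall B \near powerset_filter_from F, sval K0 `<=` ~` closure B.
  apply: K0c => x K0x.
  have [B FB nBx] : exists2 B, F B & ~ closure B x.
    apply: contrapT => nB; have : (\bigcup_(K in A) sval K `&` cluster F) x.
      split; first by exists K0.
      move=> B C FB Cx; apply: contrapT => nBC; apply: nB; exists B => //.
      by move=> /(_ _ Cx).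
    by rewrite nF.
  exists (~` closure B, [set C | F C /\ C `<=` B]) => /=.
    split; last exact: powerset_filter_fromP.
    by apply: open_nbhs_nbhs; split=> //; exact/closed_openC/closed_closure.
  by move=> [y C] [/= By [_ CB]] Cy; apply: By; exact: closureS CB _ Cy.
rewrite near_powerset_filter_fromP; last first.
  by move=> B C BC KC x /KC nC Bx; apply: nC; exact: closureS BC _ Bx.
move=> [B FB K0B].
have Uo : open (~` closure B) by exact/closed_openC/closed_closure.
have [K [[AK [x [Kx Bx]]] KB]] :
    (A `&` [set K : continua X | sval K `&` B !=set0]) `&`
    [set K : continua X | sval K `<=` ~` closure B] !=set0.
  by apply: clK0; [exists B|exact: vietoris_sub_nbhs].
by apply: (KB _ Kx); exact: subset_closure.
Qed.

End Vietoris.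

Section UnionOfContinua.
Context (R : realType) (X : topologicalType) (d : X -> X -> R).
Hypotheses (dm : is_metric d) (dt : induces_topology d).

(** Disjoint open [U] and [V] covering the union sort the members, each being connected, into those
    inside [U] and those inside [V]; both classes are Vietoris open, so connectedness of [A] leaves
    only one. *)
Lemma continuum_bigcup_continua (A : set (continua X)) :
  A !=set0 -> compact A -> connected A -> is_continuum (\bigcup_(K in A) sval K).
Proof.
move=> [K AK] Ac Acon; have UAc := compact_bigcup_continua Ac; split=> //.
  by have [[x Kx] _ _] := svalP K; exists x; exists K.
have UAcl : closed (\bigcup_(K in A) sval K).
  by apply: compact_closed UAc; exact: metric_space_hausdorff dm dt.
apply: closed_connected dm dt UAcl _ => U V Uo Vo UV UAUV.
have [||AU|AV] := connected_subset_open Acon (vietoris_open_sub Uo)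
  (vietoris_open_sub Vo).
- move=> L AL; have [_ _ Lc] := svalP L; apply: (connected_subset_open Lc Uo Vo).
    by move=> x Lx; apply: UAUV; exists L.
  by rewrite -setIA UV setI0.
- rewrite -subset0 => L [[_ LU] LV]; have [[x Lx] _ _] := svalP L.
  by rewrite -[set0 L]/(set0 x) -UV; split; [exact: LU|exact: LV].
- by left=> x [L AL Lx]; exact: AU Lx.
- by right=> x [L AL Lx]; exact: AV Lx.
Qed.

(** For [x] in [K] but not in [L], take disjoint open sets around [x] and around [L]: no continuum
    both meets the first and lies inside the second. *)
Lemma vietoris_hausdorff : hausdorff_space (continua X).
Proof.
have sub (K L : continua X) : cluster (nbhs K) L -> sval K `<=` sval L.
  move=> KL x Kx; apply: contrapT => Lx.
  have LC : closed (sval L) := continuum_closed dm dt (svalP L).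
  have [|U [V [Uo Vo xU LV UV]]] :=
      metric_separation dm dt (continuum_closed dm dt (continuum_set1 x)) LC.
    by rewrite -subset0 => y [->].
  have [M [[y [My Uy]] MV]] : [set M : continua X | sval M `&` U !=set0] `&`
      [set M : continua X | sval M `<=` V] !=set0.
    apply: KL; last exact: vietoris_sub_nbhs.
    by apply: vietoris_meet_nbhs => //; exists x; split=> //; exact: xU.
  by rewrite -[False]/(set0 y) -UV; split=> //; exact: MV.
move=> K L KL; apply: continua_eq; apply/seteqP; split; first exact: sub.
by apply: sub; move=> A B LA KB; rewrite setIC; exact: KL.
Qed.

End UnionOfContinua.

(** * Whitney maps *)

Section Whitney.
Context (R : realType) (X : topologicalType) (d : X -> X -> R) (u : nat -> X).
Hypotheses (dm : is_metric d) (dt : induces_topology d).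
Hypothesis u_dense : forall x e, 0 < e -> exists n, d (u n) x < e.

(** For nonempty [K], [peak n K] is [1 / (1 + dist (u n, K))]: it grows with [K] and stays in
    [[0, 1]] even when [d] is unbounded. *)
Let h n x : R := (1 + d (u n) x)^-1.
Let peak n (K : set X) : R := sup (h n @` K).
Let whitney_sum N (K : set X) : R := \sum_(n < N) 2^-1 ^+ n * peak n K.

(** The terms are nonnegative on nonempty sets, so the sum of the series is the supremum of its
    partial sums. *)
Definition whitney (K : set X) : R := sup (range (whitney_sum^~ K)).

Let h_itv n x : 0 <= h n x <= 1.
Proof.
have [dge0 _ _ _] := dm; have := dge0 (u n) x => dx.
by rewrite invr_ge0 invf_le1; lra.
Qed.

Let h_ubound n (K : set X) : has_ubound (h n @` K).
Proof. by exists 1 => _ [x _ <-]; case/andP: (h_itv n x). Qed.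

Let h_le_peak n (K : set X) x : K x -> h n x <= peak n K.
Proof. by move=> Kx; apply: ub_le_sup; [exact: h_ubound|exists x]. Qed.

Let peak_le n (K : set X) c :
  K !=set0 -> (forall x, K x -> h n x <= c) -> peak n K <= c.
Proof.
move=> [x Kx] Kc; apply: ge_sup; first by exists (h n x), x.
by move=> _ [y Ky <-]; exact: Kc.
Qed.

Let peak_itv n (K : set X) : K !=set0 -> 0 <= peak n K <= 1.
Proof.
move=> [x Kx]; apply/andP; split.
  by apply: le_trans (h_le_peak n Kx); case/andP: (h_itv n x).
by apply: peak_le; [exists x|move=> y _; case/andP: (h_itv n y)].
Qed.

Let peak_mono n (K L : set X) : K !=set0 -> K `<=` L -> peak n K <= peak n L.
Proof. by move=> K0 KL; apply: peak_le => // x /KL; exact: h_le_peak. Qed.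

Let weight_gt0 n : 0 < 2^-1 ^+ n :> R.
Proof. by rewrite exprn_gt0. Qed.

Let whitney_sumS N K :
  whitney_sum N.+1 K = whitney_sum N K + 2^-1 ^+ N * peak N K.
Proof. by rewrite /whitney_sum big_ord_recr. Qed.

Let whitney_sum_mono N M (K : set X) : K !=set0 -> (N <= M)%N ->
  whitney_sum N K <= whitney_sum M K.
Proof.
move=> K0; elim: M => [|M IH]; first by rewrite leqn0 => /eqP ->.
rewrite leq_eqVlt => /predU1P[->//|/IH]; rewrite whitney_sumS.
move=> /le_trans; apply; rewrite lerDl mulr_ge0 ?(ltW (weight_gt0 _)) //.
by case/andP: (peak_itv M K0).
Qed.

Let whitney_sum_tail N M (K : set X) : K !=set0 ->
  whitney_sum M K <= whitney_sum N K + 2 * 2^-1 ^+ N.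
Proof.
move=> K0; have [MN|/ltnW] := leqP M N.
  have := whitney_sum_mono K0 MN; have := weight_gt0 N; lra.
(* Once the full geometric remainder [2 * 2^-M] is added, the partial sums are nonincreasing in [M],
   and induction applies. *)
have -> : whitney_sum M K = whitney_sum M K + 2 * 2^-1 ^+ M - 2 * 2^-1 ^+ M.
  by lra.
move=> NM; suff : whitney_sum M K + 2 * 2^-1 ^+ M <=
    whitney_sum N K + 2 * 2^-1 ^+ N by have := weight_gt0 M; lra.
elim: M NM => [|M IH]; first by rewrite leqn0 => /eqP ->.
rewrite leq_eqVlt => /predU1P[->//|/IH]; rewrite whitney_sumS exprS.
have /andP[_ p1] := peak_itv M K0; have w0 := weight_gt0 M.
have := ler_wpM2l (ltW w0) p1; lra.
Qed.

Let whitney_ubound (K : set X) : K !=set0 ->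
  has_ubound (range (whitney_sum^~ K)).
Proof.
by move=> K0; exists (whitney_sum 0 K + 2 * 2^-1 ^+ 0) => _ [N _ <-];
  exact: whitney_sum_tail.
Qed.

Let whitney_sum_le N (K : set X) : K !=set0 -> whitney_sum N K <= whitney K.
Proof. by move=> K0; apply: ub_le_sup; [exact: whitney_ubound|exists N]. Qed.

Let whitney_le N (K : set X) : K !=set0 ->
  whitney K <= whitney_sum N K + 2 * 2^-1 ^+ N.
Proof.
move=> K0; apply: ge_sup; first by exists (whitney_sum 0 K), 0%N.
by move=> _ [M _ <-]; exact: whitney_sum_tail.
Qed.

Lemma whitney_mono (K L : set X) : K !=set0 -> K `<=` L -> whitney K <= whitney L.
Proof.
move=> K0 KL; have L0 : L !=set0 by case: K0 => x /KL; exists x.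
apply: ge_sup; first by exists (whitney_sum 0 K), 0%N.
move=> _ [N _ <-]; apply: le_trans (whitney_sum_le N L0).
by apply: ler_sum => n _; rewrite ler_wpM2l ?(ltW (weight_gt0 _)) ?peak_mono.
Qed.

(* A dense point close to a point of [L] outside [K] gives a strictly larger term. *)
Lemma whitney_strict (K L : set X) :
  K !=set0 -> closed K -> K `<` L -> whitney K < whitney L.
Proof.
move=> K0 Kcl [KL /existsNP[x /not_implyP[Lx Kx]]].
have [dge0 _ dC dtri] := dm.
have L0 : L !=set0 by exists x.
have /(dt x)[e e0 eK] : nbhs x (~` K).
  by apply: open_nbhs_nbhs; split=> //; exact: closed_openC.
have e20 : 0 < e / 2 by lra.
have [n xn] := u_dense x e20.
(* [K] misses the ball of radius [e] about [x], and [u n] is within [e / 2] of [x], so every point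
   of [K] is at least [e / 2] away from [u n]. *)
have pK : peak n K <= (1 + e / 2)^-1.
  apply: peak_le => // y Ky; rewrite /h lef_pV2 ?posrE; last 2 first.
  - by have := dge0 (u n) y; lra.
  - by lra.
  rewrite lerD2l leNgt; apply/negP => ny; apply: (eK y) => //=.
  by have := dtri x (u n) y; rewrite (dC x (u n)); lra.
have pL : (1 + e / 2)^-1 < peak n L.
  apply: lt_le_trans (h_le_peak n Lx); rewrite /h ltf_pV2 ?posrE; first by lra.
  - by lra.
  - by have := dge0 (u n) x; lra.
(* The gain in the single term [n] is shared by all partial sums beyond it, which keeps the
   inequality strict after the supremum. *)
pose c := 2^-1 ^+ n * (peak n L - peak n K).
have c0 : 0 < c by rewrite mulr_gt0 ?weight_gt0 //; lra.
suff : whitney K <= whitney L - c by lra.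
apply: ge_sup; first by exists (whitney_sum 0 K), 0%N.
move=> _ [N _ <-].
apply: le_trans (_ : whitney_sum (maxn N n.+1) K <= _).
  by apply: whitney_sum_mono => //; exact: leq_maxl.
rewrite lerBrDr; apply: le_trans (whitney_sum_le (maxn N n.+1) L0).
have nN : (n < maxn N n.+1)%N by exact: leq_maxr.
rewrite /whitney_sum (bigD1 (Ordinal nN)) //= [leRHS](bigD1 (Ordinal nN)) //=.
rewrite addrAC /c -mulrDr subrKC lerD2l.
by apply: ler_sum => m _; rewrite ler_wpM2l ?(ltW (weight_gt0 _)) ?peak_mono.
Qed.

(** Inclusion neighbourhoods bound the supremum from above, meeting neighbourhoods from below. *)
Let peak_continuous n : continuous (fun K : continua X => peak n (sval K)).
Proof.
have hc : continuous (h n).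
  move=> x; have [dge0 _ _ _] := dm; apply: cvgV.
    by have := dge0 (u n) x; lra.
  by apply: cvgD; [exact: cvg_cst|exact: (metric_continuous dm dt (x := u n))].
move=> K; have [K0 _ _] := svalP K.
apply/(@cvgrPdist_le _ _ _ (nbhs (K : continua X))) => e e0.
have [_ [x Kx <-] hx] : exists2 r, (h n @` sval K) r & peak n (sval K) - e < r.
  apply: sup_adherent => //; split; last exact: h_ubound.
  by case: K0 => x Kx; exists (h n x), x.
near=> L.
have [L0 _ _] := svalP L; rewrite ler_norml; apply/andP; split.
  rewrite lerBrDl -lerBrDr opprK; apply: peak_le => // y Ly.
  apply: ltW; move: y Ly; near: L.
  apply: vietoris_sub_nbhs.
    apply: (@open_comp _ _ (h n) [set r | r < peak n (sval K) + e]).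
      by move=> y _; exact: hc.
    exact: open_lt.
  by move=> y Ky /=; have := h_le_peak n Ky; lra.
rewrite lerBlDr.
have [y [Ly /= hy]] :
    sval L `&` [set y | peak n (sval K) - e < h n y] !=set0.
  near: L; apply: vietoris_meet_nbhs; last by exists x.
  apply: (@open_comp _ _ (h n) [set r | peak n (sval K) - e < r]).
    by move=> y _; exact: hc.
  exact: open_gt.
by have := h_le_peak n Ly; lra.
Unshelve. all: by end_near. Qed.

(** The tail bound does not depend on the continuum, so the partial sums converge uniformly. *)
Lemma whitney_continuous : continuous (fun K : continua X => whitney (sval K)).
Proof.
have sc N : continuous (fun K : continua X => whitney_sum N (sval K)).
  elim: N => [|N IH].
    rewrite (_ : (fun K : continua X => _) = cst 0); first exact: cst_continuous.
    by apply/funext => K; rewrite /whitney_sum big_ord0.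
  rewrite (_ : (fun K : continua X => _) =
      (fun K : continua X => whitney_sum N (sval K)) \+
      (cst (2^-1 ^+ N) \* (fun K : continua X => peak N (sval K)))); last first.
    by apply/funext => K; rewrite whitney_sumS.
  move=> K; apply: continuousD; first exact: IH.
  by apply: continuousM; [exact: cst_continuous|exact: peak_continuous].
move=> K; have [K0 _ _] := svalP K.
apply/(@cvgrPdist_lt _ _ _ (nbhs (K : continua X))) => e e0.
have [N Ne] : exists N, 2 * 2^-1 ^+ N < e / 2 :> R.
  have h1 : `|2^-1 : R| < 1 by rewrite ger0_norm; lra.
  have e40 : 0 < e / 4 by lra.
  have [N _ /(_ _ (leqnn N)) Ne] := cvgr_lt _ (cvg_expr h1) _ e40.
  by exists N; lra.
have /(@cvgrPdist_lt _ _ _ (nbhs (K : continua X))) scK := sc N K.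
near=> L; have [L0 _ _] := svalP L.
have : `|whitney_sum N (sval K) - whitney_sum N (sval L)| < e / 2.
  by near: L; apply: scK; lra.
rewrite !ltr_norml => /andP[? ?].
have := whitney_le N K0; have := whitney_sum_le N K0.
have := whitney_le N L0; have := whitney_sum_le N L0; lra.
Unshelve. all: by end_near. Qed.

End Whitney.

(** * Order arcs *)

(** Hausdorff's maximality principle, with maximality as a comparability test: this is how a new
    continuum is shown to belong to the chain. *)
Lemma maximal_chain (T : Type) (P : set (set T)) :
  exists M, [/\ M `<=` P, total_on M subset
    & forall C, P C -> (forall A, M A -> A `<=` C \/ C `<=` A) -> M C].
Proof.
have [F FP Ftot|M [[MP Mtot] Mmax]] :=
    @Zorn_bigcup _ [set M | M `<=` P /\ total_on M subset].
  split; first by move=> A [M /FP[MP _] /MP].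
  move=> A B [M FM MA] [N FN NB].
  have [MN|NM] := Ftot _ _ FM FN.
    by apply: (FP _ FN).2 => //; exact: MN.
  by apply: (FP _ FM).2 => //; exact: NM.
exists M; split=> // C PC CM; apply: contrapT => nMC.
apply: (Mmax (M `|` [set C])).
  by split; [move=> A MA; left|move=> MC; apply: nMC; apply: MC; right].
split; first by move=> A [/MP|->].
move=> A B [MA|->] [MB|->].
- exact: Mtot.
- exact: CM.
- by have [] := CM _ MB; [right|left].
- by left.
Qed.

Section OrderArc.
Context (R : realType) (X : topologicalType) (d : X -> X -> R) (u : nat -> X).
Hypotheses (dm : is_metric d) (dt : induces_topology d).
Hypothesis u_dense : forall x e, 0 < e -> exists n, d (u n) x < e.

Let mu : set X -> R := whitney d u.

Let mu_lim (F : set_system (continua X)) (P : continua X) (D : set R) :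
  ProperFilter F -> F --> P -> closed D -> F [set L | D (mu (sval L))] ->
  D (mu (sval P)).
Proof.
move=> FF FP Dcl FD; have muP := @whitney_continuous _ _ _ u dm dt P.
exact: (@closed_cvg _ _ F FF _ _ Dcl FD _ (cvg_comp _ _ FP muP)).
Qed.

(** Directed upwards, the chain converges in the Vietoris topology to the closure of its union, and
    the bound passes to the limit by continuity of [mu]. *)
Lemma whitney_closure_bigcup (S : set (set X)) (P : continua X) (c : R) :
  S !=set0 -> S `<=` @is_continuum X -> total_on S subset ->
  sval P = closure (\bigcup_(A in S) A) ->
  (forall A, S A -> mu A <= c) -> mu (sval P) <= c.
Proof.
move=> [A0 SA0] Sc Stot PE Sle.
pose F := filter_from S
  (fun A => [set L : continua X | S (sval L) /\ A `<=` sval L]).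
have FF : ProperFilter F.
  apply: filter_from_proper; last by move=> A SA; exists (exist _ A (Sc _ SA)); split.
  apply: filter_from_filter; first by exists A0.
  move=> A B SA SB; have [AB|BA] := Stot _ _ SA SB; [exists B|exists A] => //.
    by move=> L [SL BL]; split; split=> //; exact: subset_trans BL.
  by move=> L [SL AL]; split; split=> //; exact: subset_trans AL.
apply: (@mu_lim F P [set r | r <= c]).
- apply: cvg_vietoris => U Uo.
    move=> PU; exists A0 => // L [SL _] x Lx; apply: PU; rewrite PE.
    by apply: subset_closure; exists (sval L).
  rewrite PE => -[x [clx Ux]].
  have [y [[A SA Ay] Uy]] := clx _ (open_nbhs_nbhs (conj Uo Ux)).
  by exists A => // L [_ AL]; exists y; split=> //; exact: AL.
- exact: closed_le.
- by exists A0 => // L [/Sle].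
Qed.

(** Directed downwards, the chain converges to its intersection; compactness is what makes an open
    set around the intersection contain a member. *)
Lemma whitney_bigcap (S : set (set X)) (P : continua X) (c : R) :
  S !=set0 -> S `<=` @is_continuum X -> total_on S subset ->
  sval P = \bigcap_(A in S) A ->
  (forall A, S A -> c <= mu A) -> c <= mu (sval P).
Proof.
move=> S0 Sc Stot PE Sle; have [A0 SA0] := S0.
pose F := filter_from S
  (fun A => [set L : continua X | S (sval L) /\ sval L `<=` A]).
have Sdir A B : S A -> S B -> exists2 C, S C & C `<=` A `&` B.
  move=> SA SB; have [AB|BA] := Stot _ _ SA SB; [exists A|exists B] => //.
    by move=> x Ax; split=> //; exact: AB.
  by move=> x Bx; split=> //; exact: BA.
have FF : ProperFilter F.
  apply: filter_from_proper; last by move=> A SA; exists (exist _ A (Sc _ SA)); split.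
  apply: filter_from_filter; first by exists A0.
  move=> A B SA SB; have [C SC CAB] := Sdir _ _ SA SB; exists C => //.
  by move=> L [SL LC]; split; split=> // x /LC/CAB[].
apply: (@mu_lim F P [set r | c <= r]).
- apply: cvg_vietoris => U Uo; rewrite PE.
    have Scc A : S A -> compact A /\ closed A.
      by move=> /Sc Ac; split; [case: Ac|exact: continuum_closed dm dt _ Ac].
    move=> /(compact_directed_sub S0 Scc Sdir Uo)[A SA AU].
    by exists A => // L [_ LA]; exact: subset_trans AU.
  move=> [x [PUx Ux]]; exists A0 => // L [SL _]; exists x; split=> //.
  exact: PUx SL.
- exact: closed_ge.
- by exists A0 => // L [/Sle].
Qed.

Let mu_mono (A B : set X) : is_continuum A -> A `<=` B -> mu A <= mu B.
Proof. by case=> A0 _ _; exact: whitney_mono. Qed.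

Let mu_inj (A B : set X) : is_continuum A -> A `<=` B -> mu B <= mu A -> A = B.
Proof.
move=> Ac AB; apply: contraPP => nAB; apply/negP; rewrite -ltNge.
have [A0 _ _] := Ac.
apply: whitney_strict => //; first exact: continuum_closed dm dt _ Ac.
by split=> // BA; apply: nAB; apply/seteqP.
Qed.

(* The members of the chain of measure at most [c] and at least [c] have union
   and intersection in the chain; by [continuum_between] these coincide. *)
Let chain_level (K L : continua X) (M : set (set X)) (c : R) :
  M `<=` [set A | [/\ is_continuum A, sval K `<=` A & A `<=` sval L]] ->
  total_on M subset ->
  (forall C, [/\ is_continuum C, sval K `<=` C & C `<=` sval L] ->
    (forall A, M A -> A `<=` C \/ C `<=` A) -> M C) ->
  sval K `<=` sval L -> mu (sval K) <= c <= mu (sval L) ->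
  exists2 A, M A & mu A = c.
Proof.
move=> MKL Mtot Mmax KL /andP[Kc cL].
have [Kcont Lcont] := (svalP K, svalP L); have [[k Kk] _ _] := Kcont.
have MK : M (sval K) by apply: Mmax => [|A /MKL[_ KA _]]; [split|right].
have ML : M (sval L) by apply: Mmax => [|A /MKL[_ _ AL]]; [split|left].
have Mc A : M A -> is_continuum A by move=> /MKL[].
have subtot (S : set (set X)) : S `<=` M -> total_on S subset.
  by move=> SM A B /SM MA /SM; exact: Mtot.
pose Lo := [set A | M A /\ mu A <= c].
pose Hi := [set A | M A /\ c <= mu A].
have LoHi A B : Lo A -> Hi B -> A `<=` B.
  move=> [MA Ac] [MB cB]; have [//|BA] := Mtot _ _ MA MB.
  by rewrite (mu_inj (Mc _ MB) BA) //; lra.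
have LoM : Lo `<=` M by move=> A [].
have HiM : Hi `<=` M by move=> A [].
have Lo0 : Lo !=set0 by exists (sval K).
have Hi0 : Hi !=set0 by exists (sval L).
pose P := closure (\bigcup_(A in Lo) A); pose Q := \bigcap_(A in Hi) A.
have LoP A : Lo A -> A `<=` P.
  by move=> LoA x Ax; apply: subset_closure; exists A.
have PHi A : Hi A -> P `<=` A.
  move=> HiA; have Acl := continuum_closed dm dt (Mc _ HiA.1).
  rewrite ((closure_id _).1 Acl); apply: closureS.
  by apply: bigcup_sub => B LoB; exact: LoHi.
have Pc : is_continuum P.
  apply: (continuum_closure_bigcup dm dt (L := sval L)) => //.
  - by exists k => A [/MKL[_ KA _] _]; exact: KA.
  - by move=> A [/MKL[]].
  - by case: Lcont.
have Qc : is_continuum Q.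
  apply: (continuum_bigcap dm dt) => //; first by move=> A /HiM/Mc.
  move=> A B HA HB; have [AB|BA] := Mtot _ _ HA.1 HB.1; [exists A|exists B] => //.
    by move=> x Ax; split=> //; exact: AB.
  by move=> x Bx; split=> //; exact: BA.
have PQ : P `<=` Q by move=> x Px A HiA; exact: PHi Px.
have QHi A : Hi A -> Q `<=` A by exact: bigcap_inf.
have LoHiU A : M A -> Lo A \/ Hi A.
  by move=> MA; have [Ac|cA] := leP (mu A) c; [left|right; split=> //; exact: ltW].
(* Such a [C] is comparable with the whole chain, so it belongs to [M]. Strictly between [P] and [Q]
   it could then be neither in [Lo] nor in [Hi]. *)
have PCQ C : is_continuum C -> P `<=` C -> C `<=` Q -> M C.
  move=> Cc PC CQ; apply: Mmax.
    split=> //; first by apply: subset_trans PC; exact: LoP.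
    by apply: subset_trans CQ _; exact: QHi.
  move=> A /LoHiU[/LoP AP|/QHi QA]; [left|right].
    exact: subset_trans PC.
  exact: subset_trans QA.
have PQE : P = Q.
  apply/seteqP; split=> //; apply: contrapT => QP.
  have [C [Cc [PC nCP] [CQ nQC]]] := continuum_between dm dt Pc Qc (conj PQ QP).
  have [/LoP CP|/QHi QC] := LoHiU _ (PCQ _ Cc PC CQ); first exact: nCP.
  exact: nQC.
exists P; first by apply: PCQ.
apply/eqP; rewrite eq_le; apply/andP; split.
  apply: (@whitney_closure_bigcup Lo (exist _ P Pc)) => //.
  - by move=> A /LoM/Mc.
  - exact: subtot.
  - by move=> A [].
rewrite PQE; apply: (@whitney_bigcap Hi (exist _ Q Qc)) => //.
- by move=> A /HiM/Mc.
- exact: subtot.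
- by move=> A [].
Qed.

Lemma order_arc (K L : continua X) : sval K `<=` sval L ->
  exists f : R -> continua X, [/\ continuous f,
    forall t, sval K `<=` sval (f t) /\ sval (f t) `<=` sval L,
    forall t, mu (sval K) <= t <= mu (sval L) -> mu (sval (f t)) = t,
    f (mu (sval K)) = K & f (mu (sval L)) = L].
Proof.
move=> KL; have [M [MKL Mtot Mmax]] := maximal_chain
  [set A | [/\ is_continuum A, sval K `<=` A & A `<=` sval L]].
have muKL := mu_mono (svalP K) KL.
(* Clamping makes the parametrisation total and constant beyond both ends; the Lipschitz bound
   [clampD] controls the values at [t + e] and [t - e]. *)
pose clamp (t : R) := Num.max (mu (sval K)) (Num.min t (mu (sval L))).
have clampP t : mu (sval K) <= clamp t <= mu (sval L).
  by rewrite /clamp le_max lexx ge_max muKL ge_min lexx orbT.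
have clampD s t : s <= t -> clamp s <= clamp t <= clamp s + (t - s).
  have minD (a x y : R) : x <= y ->
      Num.min x a <= Num.min y a <= Num.min x a + (y - x).
    by move=> xy; case: (leP x a); case: (leP y a); lra.
  have maxD (a x y : R) : x <= y ->
      Num.max a x <= Num.max a y <= Num.max a x + (y - x).
    by move=> xy; case: (leP a x); case: (leP a y); lra.
  move=> /(minD (mu (sval L)))/andP[m1 m2].
  by have := maxD (mu (sval K)) _ _ m1; rewrite -/(clamp s) -/(clamp t); lra.
have clamp_id t : mu (sval K) <= t <= mu (sval L) -> clamp t = t.
  by case/andP=> Kt tL; rewrite /clamp (min_idPl tL); apply/max_idPr.
have lev t := cid2 (chain_level MKL Mtot Mmax KL (clampP t)).
have Mc A : M A -> is_continuum A by move=> /MKL[].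
pose f t : continua X := exist _ (s2val (lev t)) (Mc _ (s2valP (lev t))).
have Mf t : M (sval (f t)) := s2valP (lev t).
have muf t : mu (sval (f t)) = clamp t := s2valP' (lev t).
have fmono s t : s <= t -> sval (f s) `<=` sval (f t).
  move=> /clampD/andP[st _]; have [//|ts] := Mtot _ _ (Mf s) (Mf t).
  by rewrite (mu_inj (Mc _ (Mf t)) ts) // !muf.
exists f; split.
- move=> t; apply: cvg_vietoris => U Uo.
    (* [f t] is the intersection of the later members, which has the same [mu]; by compactness an
       open set around [f t] contains one of them, hence all members up to it. *)
    pose S := [set sval (f s) | s in [set s | t < s]].
    have S0 : S !=set0 by exists (sval (f (t + 1))), (t + 1) => //=; lra.
    have Sc A : S A -> is_continuum A by move=> [s _ <-]; exact/Mc/Mf.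
    have Sdir A B : S A -> S B -> exists2 C, S C & C `<=` A `&` B.
      move=> [r tr <-] [s ts <-].
      have [rs|/ltW sr] := leP r s; [exists (sval (f r))|exists (sval (f s))].
      + by exists r.
      + by move=> x frx; split=> //; exact: fmono frx.
      + by exists s.
      + by move=> x fsx; split=> //; exact: fmono fsx.
    have Qc := continuum_bigcap dm dt S0 Sc Sdir.
    have fQ : sval (f t) = \bigcap_(A in S) A.
      apply: mu_inj; first exact/Mc/Mf.
        by move=> x fx _ [s /= ts <-]; exact: fmono (ltW ts) _ fx.
      rewrite muf; apply/ler_addgt0Pr => e e0.
      have te : t <= t + e by lra.
      apply: (@le_trans _ _ (mu (sval (f (t + e))))).
        by apply: mu_mono => //; apply: bigcap_inf; exists (t + e) => //=; lra.
      by rewrite muf; have /andP[_] := clampD _ _ te; lra.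
    have Scc A : S A -> compact A /\ closed A.
      by move=> /Sc Ac; split; [case: Ac|exact: continuum_closed dm dt _ Ac].
    rewrite fQ => /(compact_directed_sub S0 Scc Sdir Uo)[_ [s /= ts <-] fsU].
    have : nbhs t [set r | r < s] by apply: open_nbhs_nbhs; split=> //; exact: open_lt.
    by apply: filterS => r /= /ltW/fmono rs; exact: subset_trans rs fsU.
  (* Dually, [f t] is the closure of the union of the earlier members, so an open set meeting [f t]
     meets one of them and all later ones. *)
  pose S := [set sval (f s) | s in [set s | s < t]].
  have S0 : S !=set0 by exists (sval (f (t - 1))), (t - 1) => //=; lra.
  have Sft A : S A -> A `<=` sval (f t) by move=> [s /= /ltW st <-]; exact: fmono.
  have Pc : is_continuum (closure (\bigcup_(A in S) A)).
    apply: (continuum_closure_bigcup dm dt (L := sval (f t))) => //.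
    + have [[k Kk] _ _] := svalP K; exists k => _ [s _ <-].
      by have [_ Kf _] := MKL _ (Mf s); exact: Kf.
    + by move=> A SA; split; [case: SA => s _ <-; exact/Mc/Mf|exact: Sft].
    + by have [] := svalP (f t).
  have Pft : closure (\bigcup_(A in S) A) `<=` sval (f t).
    rewrite ((closure_id _).1 (continuum_closed dm dt (svalP (f t)))).
    by apply: closureS; apply: bigcup_sub.
  have PE : closure (\bigcup_(A in S) A) = sval (f t).
    apply: mu_inj => //; rewrite muf; apply/ler_addgt0Pr => e e0.
    have te : t - e <= t by lra.
    have : mu (sval (f (t - e))) <= mu (closure (\bigcup_(A in S) A)).
      apply: mu_mono; first exact/Mc/Mf.
      move=> x fx; apply: subset_closure; exists (sval (f (t - e))) => //.
      by exists (t - e) => //=; lra.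
    by rewrite muf; have /andP[_] := clampD _ _ te; lra.
  rewrite -PE => -[x [clx Ux]].
  have [y [[_ [s /= st <-] fsy] Uy]] := clx _ (open_nbhs_nbhs (conj Uo Ux)).
  have : nbhs t [set r | s < r] by apply: open_nbhs_nbhs; split=> //; exact: open_gt.
  by apply: filterS => r /= /ltW/fmono sr; exists y; split=> //; exact: sr.
- by move=> t; have [] := MKL _ (Mf t).
- by move=> t /clamp_id tE; rewrite muf.
- apply: continua_eq; apply/esym/mu_inj; first exact: svalP.
    by have [] := MKL _ (Mf (mu (sval K))).
  by rewrite muf clamp_id // lexx.
- apply: continua_eq; apply: mu_inj; first exact: svalP.
    by have [] := MKL _ (Mf (mu (sval L))).
  by rewrite muf clamp_id // muKL lexx.
Qed.

End OrderArc.

(** * Arc-connection of continua *)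

(** A continuous injection of a compact space into a Hausdorff one is closed, which is continuity of
    the inverse. *)
Lemma is_arc_injective (R : realType) (Z : topologicalType) (f : R -> Z) :
  hausdorff_space Z -> continuous f -> {in `[0, 1] &, injective f} ->
  is_arc R (f @` `[0, 1]).
Proof.
move=> HZ fc finj.
pose g z : R := xget 0 [set t | t \in `[0, 1] /\ f t = z].
have fK : {in `[0, 1], cancel f g}.
  move=> t t01; rewrite /g; case: xgetP => [s _ [s01 fst]|/(_ t) nt].
    exact: finj.
  by exfalso; apply: nt.
exists f, g; split=> //; first exact: continuous_subspaceT.
apply/continuous_closedP => W Wcl; apply/closed_subspaceP.
exists (f @` (W `&` `[0, 1])).
  apply: compact_closed => //; apply: continuous_compact.
    exact: continuous_subspaceT.
  rewrite setIC; apply: compact_closedI => //.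
  exact: segment_compact.
apply/seteqP; split=> z [].
  move=> [t [Wt t01] <-] ft; split=> //=.
  by move: Wt; rewrite -{1}(fK t t01).
move=> /= Wz [t t01 tz]; split; last by exists t.
exists t => //; split=> //.
by have : W (g (f t)); [rewrite tz|rewrite fK].
Qed.

Lemma continuous_paste (R : realType) (Z : topologicalType) (f g : R -> Z) (c : R) :
  continuous f -> continuous g -> f c = g c ->
  continuous (fun t => if t <= c then f t else g t).
Proof.
move=> fc gc fgc; set h := fun t => _.
have hT : {within [set t | t <= c] `|` [set t | c <= t], continuous h}.
  apply: withinU_continuous; [exact: closed_le|exact: closed_ge| |].
    apply: (@subspace_eq_continuous _ _ _ (f : subspace _ -> Z)).
      by move=> t /set_mem /= tc; rewrite /from_subspace /h tc.
    exact: continuous_subspaceT.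
  apply: (@subspace_eq_continuous _ _ _ (g : subspace _ -> Z)).
    move=> t /set_mem /= ct; rewrite /from_subspace /h.
    by case: ifP => // tc; rewrite (_ : t = c) //; apply/eqP; rewrite eq_le tc.
  exact: continuous_subspaceT.
have UT : [set t | t <= c] `|` [set t | c <= t] = [set: R].
  apply/seteqP; split=> // t _; have [tc|ct] := leP t c; [by left|right].
  exact: ltW.
by rewrite UT in hT; apply/continuous_subspace_setT.
Qed.

Section ArcConnection.
Context (R : realType) (X : topologicalType) (d : X -> X -> R) (u : nat -> X).
Hypotheses (dm : is_metric d) (dt : induces_topology d).
Hypothesis u_dense : forall x e, 0 < e -> exists n, d (u n) x < e.

(** [N] is the intersection of a maximal chain: a [B] inside it is comparable with every member,
    hence is a member, hence contains the intersection. *)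
Lemma continuum_irreducible (A M : set X) :
  A !=set0 -> is_continuum M -> A `<=` M ->
  exists N : continua X, A `<=` sval N /\
    forall B, is_continuum B -> A `<=` B -> B `<=` sval N -> B = sval N.
Proof.
move=> [a Aa] Mc AM; have [C [CP Ctot Cmax]] := maximal_chain
  [set B | is_continuum B /\ A `<=` B].
have Cdir B D : C B -> C D -> exists2 E, C E & E `<=` B `&` D.
  move=> CB CD; have [BD|DB] := Ctot _ _ CB CD; [exists B|exists D] => //.
    by move=> x Bx; split=> //; exact: BD.
  by move=> x Dx; split=> //; exact: DB.
have C0 : C !=set0.
  apply: contrapT => /nonemptyPn C0; have : C M; last by rewrite C0.
  by apply: Cmax => // B; rewrite C0.
have Nc : is_continuum (\bigcap_(B in C) B).
  by apply: (continuum_bigcap dm dt) => // B /CP[].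
exists (exist _ _ Nc); split; first by move=> x Ax B /CP[_]; exact.
move=> B Bc AB BN; apply/seteqP; split=> //=.
apply: bigcap_inf; apply: Cmax => // D CD; right.
by apply: subset_trans BN _; exact: bigcap_inf.
Qed.

(* Two order arcs ending in a continuum irreducible about the union of [K] and
   [L] meet only there, so that running through the first one forwards and the
   second one backwards is injective. *)
Lemma continuum_arc_connected (K L : continua X) (M : set X) :
  is_continuum M -> sval K `<=` M -> sval L `<=` M -> arc_connected R K L.
Proof.
move=> Mc KM LM; have [KL|KL] := pselect (K = L); [by left|right].
have [N [KLN Nmin]] : exists N : continua X, sval K `|` sval L `<=` sval N /\
    forall B, is_continuum B -> sval K `|` sval L `<=` B ->
      B `<=` sval N -> B = sval N.
  apply: continuum_irreducible Mc _; last by move=> x [/KM|/LM].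
  by have [[k Kk] _ _] := svalP K; exists k; left.
have KN : sval K `<=` sval N by move=> x Kx; apply: KLN; left.
have LN : sval L `<=` sval N by move=> x Lx; apply: KLN; right.
have [f [fc fsub fmu fK fN]] := order_arc dm dt u_dense KN.
have [g [gc gsub gmu gL gN]] := order_arc dm dt u_dense LN.
pose mu (A : continua X) := whitney d u (sval A).
rewrite -/(mu N) -/(mu K) in fmu fK fN; rewrite -/(mu N) -/(mu L) in gmu gL gN.
have muKN : mu K <= mu N.
  by have [K0 _ _] := svalP K; exact: whitney_mono.
have muLN : mu L <= mu N.
  by have [L0 _ _] := svalP L; exact: whitney_mono.
(* The second arc is run backwards by [t |-> 2 * mu N - t], which fixes the junction [mu N] and
   reaches [L] at [2 * mu N - mu L]. *)
pose h t := if t <= mu N then f t else g (2 * mu N - t).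
have hc : continuous h.
  apply: continuous_paste => //; last by rewrite fN (_ : _ - _ = mu N) ?gN //; lra.
  move=> t; apply: (@continuous_comp _ _ _ (fun t => 2 * mu N - t) g).
    by apply: cvgB; [exact: cvg_cst|exact: cvg_id].
  exact: gc.
have h_neq s t : mu K <= s -> s < t -> t <= 2 * mu N - mu L -> h s <> h t.
  move=> Ks st te; rewrite /h; case: (leP s) => sN; case: (leP t) => tN hst.
  - have Es : mu (f s) = s by apply: fmu; lra.
    have Et : mu (f t) = t by apply: fmu; lra.
    by move: Es; rewrite hst Et ; lra.
  (* A value taken on both sides of the junction contains [K] and [L] and lies inside [N], so it is
     [N] by minimality; but beyond the junction [mu] is below [mu N]. *)
  - have fsN : sval (f s) = sval N.
      apply: Nmin; [exact: svalP| |by have [] := fsub s].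
      move=> x [Kx|Lx]; first by have [Kf _] := fsub s; exact: Kf.
      by rewrite hst; have [Lg _] := gsub (2 * mu N - t); exact: Lg.
    have Et : mu (g (2 * mu N - t)) = 2 * mu N - t by apply: gmu; lra.
    by move: Et; rewrite -hst /mu fsN -/(mu N) ; lra.
  - by move: (lt_le_trans st tN); rewrite ltNge (ltW sN).
  - have Es : mu (g (2 * mu N - s)) = 2 * mu N - s by apply: gmu; lra.
    have Et : mu (g (2 * mu N - t)) = 2 * mu N - t by apply: gmu; lra.
    by move: Es; rewrite hst Et ; lra.
(* If the parameter interval collapsed, [mu K], [mu N] and [mu L] would agree, and [K], [N] and [L]
   would coincide. *)
have ae : mu K < 2 * mu N - mu L.
  rewrite ltNge; apply/negP => ea; apply: KL.
  have KE : mu K = mu N by lra.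
  have LE : mu L = mu N by lra.
  by rewrite -fK KE fN -gL LE gN.
pose l t := mu K + t * (2 * mu N - mu L - mu K).
have lc : continuous l.
  move=> t; apply: cvgD; first exact: cvg_cst.
  by apply: cvgM; [exact: cvg_id|exact: cvg_cst].
have l_lt s t : s < t -> l s < l t.
  by move=> st; rewrite ltrD2l ltr_pM2r //; lra.
have l_itv t : t \in `[0, 1] -> mu K <= l t <= 2 * mu N - mu L.
  rewrite in_itv /= => /andP[]; rewrite !le_eqVlt.
  have l0 : l 0 = mu K by rewrite /l; lra.
  have l1 : l 1 = 2 * mu N - mu L by rewrite /l; lra.
  move=> /predU1P[<-|/l_lt t0] /predU1P[->|/l_lt t1]; lra.
exists ((h \o l) @` `[0, 1]); split.
- apply: is_arc_injective.
  + exact: vietoris_hausdorff dm dt.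
  + by move=> t; apply: continuous_comp; [exact: lc|exact: hc].
  + move=> s t /l_itv/andP[s0 s1] /l_itv/andP[t0 t1] hst.
    by case: (ltgtP s t) => // /l_lt st; exfalso;
      [apply: (h_neq (l s) (l t))|apply: (h_neq (l t) (l s))].
- exists 0; first by rewrite /= in_itv /= lexx ler01.
  by rewrite /= (_ : l 0 = mu K) /h ?muKN // /l; lra.
- exists 1; first by rewrite /= in_itv /= lexx ler01.
  rewrite /= (_ : l 1 = 2 * mu N - mu L); last by rewrite /l; lra.
  rewrite /h; case: leP => e; last by rewrite (_ : _ - _ = mu L) //; lra.
  (* Here the second arc is trivial and its end is the junction, where [h] follows [f]. *)
  have LE : mu L = mu N by lra.
  have -> : 2 * mu N - mu L = mu N by lra.
  by rewrite fN -[RHS]gL LE gN.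
Qed.

Lemma arc_connected_continuum (K L : continua X) : arc_connected R K L ->
  exists M, [/\ is_continuum M, sval K `<=` M & sval L `<=` M].
Proof.
move=> [<-|[A [[f [_ [<- _ fc _]]] AK AL]]].
  by exists (sval K); split=> //; exact: svalP.
exists (\bigcup_(M in f @` `[0, 1]) sval M); split; last 2 first.
- by move=> x Kx; exists K.
- by move=> x Lx; exists L.
apply: (continuum_bigcup_continua dm dt); first by exists K.
  by apply: continuous_compact fc _; exact: segment_compact.
by apply: connected_continuous_connected fc; exact: segment_connected.
Qed.

End ArcConnection.

(** * A Borel selector for continua *)

Section Borel.
Context (T : topologicalType).
Implicit Types A B : set T.

Lemma borel_open A : open A -> borel_set A.
Proof. exact: sub_sigma_algebra. Qed.

Lemma borel_setC A : borel_set A -> borel_set (~` A).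
Proof.
by move=> BA; rewrite -setTD; apply: sigma_algebraCD => //; exact: smallest_sigma_algebra.
Qed.

Lemma borel_closed A : closed A -> borel_set A.
Proof.
by move=> /closed_openC/borel_open/borel_setC; rewrite setCK.
Qed.

Lemma borel_bigcup (F : nat -> set T) :
  (forall n, borel_set (F n)) -> borel_set (\bigcup_n F n).
Proof. exact: sigma_algebra_bigcup. Qed.

Lemma borel_bigcap (F : nat -> set T) :
  (forall n, borel_set (F n)) -> borel_set (\bigcap_n F n).
Proof.
move=> BF; rewrite -[X in borel_set X]setCK setC_bigcap; apply: borel_setC.
by apply: borel_bigcup => n; exact: borel_setC.
Qed.

Lemma borel_set0 : borel_set (@set0 T).
Proof. exact: borel_open open0. Qed.

Lemma borel_setI A B : borel_set A -> borel_set B -> borel_set (A `&` B).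
Proof.
move=> BA BB; rewrite -bigcap2E; apply: borel_bigcap => -[|[|n]] //=.
exact: borel_open openT.
Qed.

End Borel.

(** Closed test sets suit the selector, whose compactness argument [shrink_meet] works for closed
    sets. *)
Lemma borel_map_closed (T U : topologicalType) (f : T -> U) :
  (forall C, closed C -> borel_set (f @^-1` C)) -> borel_map f.
Proof.
move=> fC; suff : <<s @open U >> `<=` [set B | borel_set (f @^-1` B)] by [].
apply: smallest_sub.
  split=> [|A BA|F BF].
  - by rewrite /= preimage_set0; exact: borel_set0.
  - by rewrite /= setTD -preimage_setC; exact: borel_setC.
  - by rewrite /= preimage_bigcup; exact: borel_bigcup.
move=> A Ao /=; rewrite -(setCK (f @^-1` A)) preimage_setC.
by apply: borel_setC; apply: fC; exact: open_closedC.
Qed.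

Lemma continuous_borel_map (T U : topologicalType) (f : T -> U) :
  continuous f -> borel_map f.
Proof.
move=> fc; apply: borel_map_closed => C Ccl; apply: borel_closed.
by apply: preimage_closed Ccl => x _; exact: fc.
Qed.

Section Selector.
Context (R : realType) (X : topologicalType) (d : X -> X -> R) (u : nat -> X).
Hypotheses (dm : is_metric d) (dt : induces_topology d).
Hypothesis u_dense : forall x e, 0 < e -> exists n, d (u n) x < e.

Let cball n i : set X := [set y | d (u i) y <= n.+1%:R^-1].
(** Taking the least index makes the choice Borel: that no earlier ball is met is a countable
    condition. *)
Let first_ball n (A : set X) : nat :=
  xget 0%N [set i | A `&` cball n i !=set0 /\
    forall j, (j < i)%N -> ~ (A `&` cball n j !=set0)].

(** Stage [n.+1] lies in a ball of radius [1 / (n + 1)], so the nested stages of a continuum shrink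
    to one point of it. *)
Let Fixpoint shrink n (K : set X) : set X :=
  if n is m.+1 then shrink m K `&` cball m (first_ball m (shrink m K)) else K.

Let first_ballP n (A : set X) : A !=set0 -> A `&` cball n (first_ball n A) !=set0 /\
  forall j, (j < first_ball n A)%N -> ~ (A `&` cball n j !=set0).
Proof.
move=> [x Ax]; rewrite /first_ball; case: xgetP => [i _ //|nA]; exfalso.
have n0 : 0 < n.+1%:R^-1 :> R by rewrite invr_gt0.
have [i xi] := u_dense x n0.
have exi : exists i, `[< A `&` cball n i !=set0 >].
  by exists i; apply/asboolP; exists x; split=> //; exact: ltW.
case: (ex_minnP exi) => k /asboolP Ak kmin; apply: (nA k); split=> // j jk.
by move=> /asboolP /kmin; rewrite leqNgt jk.
Qed.

Let shrink_closed n (K : set X) : closed K -> closed (shrink n K).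
Proof.
move=> Kcl; elim: n => //= n IH; apply: closedI => //.
exact: metric_closed_ball dm dt _ _.
Qed.

Let shrink_mono m n (K : set X) : (m <= n)%N -> shrink n K `<=` shrink m K.
Proof.
elim: n => [|n IH]; first by rewrite leqn0 => /eqP ->.
by rewrite leq_eqVlt => /predU1P[->//|/IH]; apply: subset_trans => x [].
Qed.

Let shrink_nonempty n (K : set X) : K !=set0 -> shrink n K !=set0.
Proof. by move=> K0; elim: n => //= n /(first_ballP n)[]. Qed.

(** Together with [shrink_unique] this turns membership of the selected point in a closed [C] into
    countably many conditions on the stages. *)
Let shrink_meet (K C : set X) : compact K -> closed C ->
  (forall n, shrink n K `&` C !=set0) ->
  \bigcap_n shrink n K `&` C !=set0.
Proof.
move=> Kc Ccl KC; have Kcl : closed K.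
  by apply: compact_closed => //; exact: metric_space_hausdorff dm dt.
pose S := range (fun n => shrink n K `&` C).
have Scl A : S A -> compact A /\ closed A.
  move=> [n _ <-]; have cl : closed (shrink n K `&` C).
    by apply: closedI => //; exact: shrink_closed.
  split=> //; apply: (subclosed_compact cl Kc) => x [].
  by move=> /(@shrink_mono 0 n _ isT).
have Sdir A B : S A -> S B -> exists2 D, S D & D `<=` A `&` B.
  move=> [n _ <-] [m _ <-]; exists (shrink (maxn n m) K `&` C).
    by exists (maxn n m).
  by move=> x [Kx Cx]; do 2!split=> //;
    apply: shrink_mono Kx; rewrite (leq_maxl, leq_maxr).
apply: contrapT => /nonemptyPn KC0.
have [||A [n _ <-] nA0] := compact_directed_sub _ Scl Sdir (@open0 X).
- by exists (shrink 0 K `&` C), 0%N.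
- move=> x Sx; rewrite -KC0; split; last by have [] := Sx _ (imageT _ 0%N).
  by move=> n _; have [] := Sx _ (imageT _ n).
- by have [x /nA0] := KC n.
Qed.

Let shrink_unique (K : set X) x y :
  (\bigcap_n shrink n K) x -> (\bigcap_n shrink n K) y -> x = y.
Proof.
have [dge0 d0 dC dtri] := dm => Kx Ky; apply/d0/eqP.
rewrite eq_le dge0 andbT; apply/ler_addgt0Pr => e e0; rewrite add0r.
have e20 : 0 < e / 2 by lra.
have [n ne] : exists n, n.+1%:R^-1 < e / 2.
  by have [n _ /(_ _ (leqnn n))] := near_infty_natSinv_lt (PosNum e20); exists n.
have [_ xn] := Kx n.+1 I; have [_ yn] := Ky n.+1 I.
have {}xn := le_lt_trans xn ne; have {}yn := le_lt_trans yn ne.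
have := dtri x (u (first_ball n (shrink n K))) y; rewrite (dC x (u _)).
by move=> /le_trans; apply; rewrite (splitr e) lerD // ltW.
Qed.

(** Stage [n.+1] meets [C] when, for some [i], stage [n] meets [C] within ball [i] and misses all
    earlier balls. These conditions concern closed sets at stage [n], so the induction runs over all
    closed [C]. *)
Let borel_shrink_meet n (C : set X) : closed C ->
  borel_set [set K : continua X | shrink n (sval K) `&` C !=set0].
Proof.
elim: n C => [|n IH] C Ccl; first by apply: borel_closed; exact: vietoris_closed_meet.
have Bcl i : closed (cball n i) by exact: metric_closed_ball dm dt _ _.
rewrite (_ : mkset _ = \bigcup_i
    (([set K : continua X | shrink n (sval K) `&` (cball n i `&` C) !=set0] `&`
      \bigcap_j [set K : continua X | (j < i)%N ->
        ~ (shrink n (sval K) `&` cball n j !=set0)]))).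
  apply: borel_bigcup => i; apply: borel_setI.
    by apply: IH; exact: closedI.
  apply: borel_bigcap => j; have [ji|ij] := ltnP j i.
    rewrite (_ : mkset _ = ~`
      [set K : continua X | shrink n (sval K) `&` cball n j !=set0]).
      by apply: borel_setC; exact: IH.
    by apply/seteqP; split=> K /= H; [exact: H|].
  by rewrite (_ : mkset _ = setT); [exact: borel_open openT|apply/seteqP].
apply/seteqP; split=> K /=; have [K0 _ _] := svalP K;
    have [Kn Kmin] := first_ballP n (shrink_nonempty n K0).
  move=> [x [[Kx Bx] Cx]]; exists (first_ball n (shrink n (sval K))) => //.
  by split; [exists x|move=> j _ /Kmin].
move=> [i _ [[x [Kx [Bx Cx]]] imin]]; exists x; split=> //; split=> //.
suff -> : first_ball n (shrink n (sval K)) = i by [].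
case: (ltngtP (first_ball n (shrink n (sval K))) i) => // lt_i; exfalso.
  exact: (imin _ I lt_i).
by apply: (Kmin _ lt_i); exists x.
Qed.

Lemma borel_selector : exists s : continua X -> X,
  borel_map s /\ forall K, sval K (s K).
Proof.
have ne (K : continua X) : exists x, (\bigcap_n shrink n (sval K)) x.
  have [K0 Kc _] := svalP K.
  have [|x [Kx _]] := @shrink_meet _ setT Kc (@closedT X).
    by move=> n; rewrite setIT; exact: shrink_nonempty.
  by exists x.
pose s K := projT1 (cid (ne K)).
have sK K : (\bigcap_n shrink n (sval K)) (s K) := projT2 (cid (ne K)).
exists s; split; last by move=> K; exact: (sK K 0%N I).
apply: borel_map_closed => C Ccl.
rewrite (_ : _ @^-1` _ =
  \bigcap_n [set K : continua X | shrink n (sval K) `&` C !=set0]).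
  by apply: borel_bigcap => n; exact: borel_shrink_meet.
apply/seteqP; split=> K /=.
  by move=> CsK n _; exists (s K); split=> //; exact: sK.
move=> KC; have [_ Kc _] := svalP K.
have [|x [Kx Cx]] := shrink_meet Kc Ccl; first by move=> n; exact: KC.
by rewrite (shrink_unique (sK K) Kx).
Qed.

End Selector.

(** * The two Borel reductions *)

Lemma continuumU (X : topologicalType) (A B : set X) :
  is_continuum A -> is_continuum B -> A `&` B !=set0 -> is_continuum (A `|` B).
Proof.
move=> [[a Aa] Ac Acon] [_ Bc Bcon] AB; split; first by exists a; left.
  exact: compactU.
exact: connectedU.
Qed.

(** Indices missed by the injection of [D] into the naturals need a value, whence [x0]; the empty
    space is treated apart. *)
Lemma dense_sequence (R : realType) (X : topologicalType) (d : X -> X -> R)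
    (D : set X) (x0 : X) : is_metric d -> induces_topology d ->
  countable D -> dense D ->
  exists u : nat -> X, forall x e, 0 < e -> exists n, d (u n) x < e.
Proof.
move=> dm dt /countable_injP[c cinj] Dd.
pose u n := xget x0 [set x | D x /\ c x = n].
exists u => x e e0; have [_ _ dC _] := dm.
have [||y [/= xy Dy]] := Dd [set y | d x y < e].
- by exists x; exact: nbhs_singleton (metric_nbhs_ball dt x e0).
- exact: metric_open_ball dm dt _ _.
exists (c y); rewrite /u; case: xgetP => [z _ [Dz cz]|/(_ y) ny].
  have -> : z = y by apply: cinj => //; exact: mem_set.
  by rewrite dC.
by exfalso; apply: ny.
Qed.

Theorem theorem33 (R : realType) (X : topologicalType) (hX : polish R X) :
  borel_bireducible (@continuum_connected X) (@arc_connected R (continua X)).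
Proof.
have [[D Dcount Ddense] [d [dm dt _]]] := hX.
have dense_u (x0 : X) := dense_sequence x0 dm dt Dcount Ddense.
split.
  pose f x : continua X := exist _ [set x] (continuum_set1 x).
  exists f; split; first by apply: continuous_borel_map; exact: set1_continuous.
  move=> x y; split=> [[M [Mc Mx My]]|].
    have [u u_dense] := dense_u x.
    by apply: (continuum_arc_connected dm dt u_dense Mc) => _ ->.
  by move=> /(arc_connected_continuum dm dt)[M [Mc xM yM]]; exists M; split;
    [|exact: xM|exact: yM].
have [s [s_borel sK]] : exists s : continua X -> X,
    borel_map s /\ forall K, sval K (s K).
  have [[x0 _]|X0] := pselect (exists x0 : X, True).
    by have [u u_dense] := dense_u x0; exact: borel_selector dm dt u_dense.
  (* Without points there are no continua, so the selector has empty domain. *)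
  have nK (K : continua X) : False.
    by have [[x _] _ _] := svalP K; apply: X0; exists x.
  exists (fun K => False_rect X (nK K)); split; last by move=> K; case: (nK K).
  move=> B _; rewrite (_ : _ @^-1` _ = set0); first exact: borel_set0.
  by apply/seteqP; split=> K; case: (nK K).
exists s; split=> // K L; split.
  move=> /(arc_connected_continuum dm dt)[M [Mc KM LM]]; exists M.
  by split; [|exact/KM/sK|exact/LM/sK].
move=> [M [Mc MK ML]]; have [u u_dense] := dense_u (s K).
(* [s K] lies in both [K] and [M], and [s L] in both [M] and [L], so the union of the three is
   connected. *)
have KMc : is_continuum (sval K `|` M).
  by apply: continuumU => //; [exact: svalP|exists (s K)].
apply: (continuum_arc_connected dm dt u_dense (M := sval K `|` M `|` sval L)).
- by apply: continuumU => //; [exact: svalP|exists (s L); split=> //; right].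
- by move=> x Kx; left; left.
- by move=> x Lx; right.
Qed.
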